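(* Let $\varepsilon\in(0,1)$ and assume that $\lambda_k\in[\varepsilon,2-\varepsilon]$ for all $k\ge 0$. If $\bigcap_{t=1}^{p}\operatorname{Fix}\hat U_t\neq\emptyset$, then for every starting point $x^0\in\mathbb{R}^n$ the sequence $\{x^k\}_{k=0}^\infty$ produced by $$x^{k+1}=P_{C_{[k]}}\Big(x^{k}+\frac{\lambda_k}{\|\hat A_{[k]}\|^2}\hat A_{[k]}^T\big(\hat b^{[k]}-\hat A_{[k]}x^{k}\big)\Big),\qquad k\ge 0,$$ converges to some $x^*\in\bigcap_{t=1}^{p}\operatorname{Fix}\hat U_t$. Further, if all the sets $C_t$, $t=1,\dots,p$, are polyhedral, then the iteration converges linearly.
   Context: Let $A\in\mathbb{R}^{m\times n}$ and $b\in\mathbb{R}^m$. The system $Ax=b$ is partitioned into $p$ row blocks of equations $A_tx=b^t$, $t=1,\dots,p$ (blocks may contain common equations, but each equation appears in at least one block); each $A_t$ is nonzero. For each $t$ let $M_t$ be a given symmetric positive definite matrix (of size equal to the number of rows of $A_t$), let $C_t\subseteq\mathbb{R}^n$ be a closed convex set, and put $\hat A_t=M_t^{1/2}A_t$, $\hat b^t=M_t^{1/2}b^t$. $P_C$ denotes the metric projection onto $C$, $\|\cdot\|$ the Euclidean norm (spectral norm for matrices), and $[k]:=k\ (\mathrm{mod}\ p)+1$ (cyclic control). For $t=1,\dots,p$ define $\hat U_t(x)=P_{C_t}\big(x+\frac{\lambda}{\|\hat A_t\|^2}\hat A_t^T(\hat b^t-\hat A_tx)\big)$ with a fixed $\lambda\in(0,2)$.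 Its fixed point set does not depend on $\lambda$ and equals $\operatorname{Fix}\hat U_t=\arg\min_{x\in C_t}\|b^t-A_tx\|_{M_t}^2$, where $\|y\|_{M}^2=y^TMy$. A set is polyhedral if it is the intersection of a finite family of half-spaces. Linear convergence of $x^k$ to $x^*$ means that there are $c\ge 0$ and $q\in(0,1)$ with $\|x^k-x^*\|\le c\,q^k$ for all $k\ge 0$. *)

(* Defs.v *)
From mathcomp Require Import all_boot all_order all_algebra.
From mathcomp Require Import all_classical all_reals all_analysis.

Set Implicit Arguments.
Unset Strict Implicit.
Unset Printing Implicit Defensive.

Import Order.TTheory GRing.Theory Num.Theory.
Import numFieldNormedType.Exports.

Local Open Scope classical_set_scope.
Local Open Scope ring_scope.

(* The library norm `|x| on matrices is the sup norm, hence this definition. *)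
Definition enorm (R : realType) (n : nat) (x : 'cV[R]_n) : R :=
  Num.sqrt (\sum_(i < n) x i ord0 ^+ 2).

Definition spectral_norm (R : realType) (m n : nat) (A : 'M[R]_(m, n)) : R :=
  sup [set enorm (A *m x) | x in [set x : 'cV[R]_n | enorm x <= 1]].

Definition spd (R : realType) (n : nat) (M : 'M[R]_n) : Prop :=
  M^T = M /\ forall x : 'cV[R]_n, x != 0 -> 0 < (x^T *m M *m x) ord0 ord0.

(* For M symmetric positive definite, S is unique; the default value 0 of
   [xget] is irrelevant in that case. *)
Definition sqrtmx (R : realType) (n : nat) (M : 'M[R]_n) : 'M[R]_n :=
  xget 0 [set S : 'M[R]_n | spd S /\ S *m S = M].

(* For C nonempty, closed and convex the minimizer exists and is unique; the
   default value 0 of [xget] is irrelevant in that case. *)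
Definition metric_proj (R : realType) (n : nat) (C : set 'cV[R]_n)
    (x : 'cV[R]_n) : 'cV[R]_n :=
  xget 0 [set y | C y /\ forall z, C z -> enorm (x - y) <= enorm (x - z)].

Definition halfspace (R : realType) (n : nat) (H : set 'cV[R]_n) : Prop :=
  exists (a : 'cV[R]_n) (beta : R),
    a != 0 /\ H = [set x | (a^T *m x) ord0 ord0 <= beta].

Definition polyhedral (R : realType) (n : nat) (C : set 'cV[R]_n) : Prop :=
  exists (r : nat) (H : 'I_r -> set 'cV[R]_n),
    (forall i, halfspace (H i)) /\ C = \bigcap_i H i.

Definition row_block (R : realType) (m n : nat) (I : {set 'I_m})
    (A : 'M[R]_(m, n)) : 'M[R]_(#|I|, n) :=
  rowsub (fun i : 'I_#|I| => enum_val i) A.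

Definition landweber_step (R : realType) (m n : nat) (A : 'M[R]_(m, n))
    (b : 'cV[R]_m) (M : 'M[R]_m) (C : set 'cV[R]_n) (lambda : R)
    (x : 'cV[R]_n) : 'cV[R]_n :=
  let Ahat := sqrtmx M *m A in
  let bhat := sqrtmx M *m b in
  metric_proj C
    (x + (lambda / spectral_norm Ahat ^+ 2) *: (Ahat^T *m (bhat - Ahat *m x))).

Definition Fix (T : Type) (f : T -> T) : set T := [set x | f x = x].

(* Blocks are indexed from 0, so the control k mod p + 1 becomes k mod p. *)
Definition cyclic (p : nat) (p_gt0 : (0 < p)%N) (k : nat) : 'I_p :=
  Ordinal (ltn_pmod k p_gt0).

Definition linear_cvg (R : realType) (n : nat) (x : nat -> 'cV[R]_n)
    (xs : 'cV[R]_n) : Prop :=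
  exists c q : R, [/\ 0 <= c, 0 < q, q < 1 &
    forall k : nat, enorm (x k - xs) <= c * q ^+ k].

(* Main.v *)
Require Import Defs.
From mathcomp Require Import all_boot all_order all_algebra.
From mathcomp Require Import all_classical all_reals all_analysis.
From mathcomp Require Import ring lra.

Set Implicit Arguments.
Unset Strict Implicit.

Import Order.TTheory GRing.Theory Num.Theory.
Import numFieldNormedType.Exports.

Local Open Scope classical_set_scope.
Local Open Scope ring_scope.

(** Write [G t] and [g t] for the matrix and the right hand side of block [t]
after multiplication by the square root of [M t], and [T t l] for the
corresponding projected Landweber map with relaxation [l].

Common fixed points. By the variational inequality of the projection, [z] is
fixed by [T t l] exactly when [z] lies in [C t] and minimizes the least squares
functional there, whatever [l > 0] is. Two minimizers have the same image under
[G t]. Hence, with one common fixed point [z0] at hand, the set [F] of common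
fixed points is given by the conditions [C t z] and [G t *m z = G t *m z0],
that is, by the vanishing of the Lipschitz functions
[v t z = enorm (z - P (C t) z) + enorm (G t *m (z - z0))]
([projected_landweber_fix_residual], [residual_fixP]).

Decrease. The projection is firmly nonexpansive and the gradient step is
averaged for [l] in [[eps, 2 - eps]]; together they yield [enorm (x - T t l x)
^+ 2 + v t x ^+ 2 <= kappa * (enorm (x - z) ^+ 2 - enorm (T t l x - z) ^+ 2)]
for all [z] in [F], with [kappa] independent of [l] ([residual_decrease]).

Convergence. The distances to the points of [F] are nonincreasing along the
iteration. As the control is cyclic, the decrease inequality, applied to [p]
consecutive steps, bounds every [v t (x k) ^+ 2] by a multiple of the decrease
of the squared distance from [x k] to [x (k + p)] ([residual_cycle]). So all
residuals tend to 0, a cluster point of the bounded sequence belongs to [F],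
and monotonicity of the distance to that point turns it into the limit
([cyclic_fejer_cvg]).

Rate. For polyhedral [C t] the set [F] is a polyhedron, and Hoffman's
inequality ([hoffman]) bounds the distance of [x k] to [F] by a multiple of the
sum of its residuals ([polyhedral_error_bound]). The distance [e k] of [x k] to
the limit is at most twice its distance to any point of [F], so that
[e k ^+ 2 <= c * (e k ^+ 2 - e (k + p) ^+ 2)]: every [p] steps [e] shrinks by a
fixed factor ([cyclic_fejer_linear]). *)

(** * Euclidean inner product and norm *)

Definition dot (R : realType) (n : nat) (x y : 'cV[R]_n) : R :=
  (x^T *m y) ord0 ord0.

Section Euclidean.
Context {R : realType}.
Implicit Types (n : nat) (a b : R).

Lemma dotE n (x y : 'cV[R]_n) : dot x y = \sum_(i < n) x i ord0 * y i ord0.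
Proof. by rewrite /dot mxE; apply: eq_bigr => i _; rewrite mxE. Qed.

Lemma dotC n (x y : 'cV[R]_n) : dot x y = dot y x.
Proof. by rewrite !dotE; apply: eq_bigr => i _; rewrite mulrC. Qed.

Lemma dotDr n (x y z : 'cV[R]_n) : dot x (y + z) = dot x y + dot x z.
Proof. by rewrite /dot mulmxDr mxE. Qed.

Lemma dotZr n a (x y : 'cV[R]_n) : dot x (a *: y) = a * dot x y.
Proof. by rewrite /dot -scalemxAr mxE. Qed.

Lemma dotNr n (x y : 'cV[R]_n) : dot x (- y) = - dot x y.
Proof. by rewrite /dot mulmxN mxE. Qed.

Lemma dotBr n (x y z : 'cV[R]_n) : dot x (y - z) = dot x y - dot x z.
Proof. by rewrite dotDr dotNr. Qed.

Lemma dotDl n (x y z : 'cV[R]_n) : dot (x + y) z = dot x z + dot y z.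
Proof. by rewrite dotC dotDr !(dotC z). Qed.

Lemma dotZl n a (x y : 'cV[R]_n) : dot (a *: x) y = a * dot x y.
Proof. by rewrite dotC dotZr (dotC y). Qed.

Lemma dotNl n (x y : 'cV[R]_n) : dot (- x) y = - dot x y.
Proof. by rewrite dotC dotNr (dotC y). Qed.

Lemma dotBl n (x y z : 'cV[R]_n) : dot (x - y) z = dot x z - dot y z.
Proof. by rewrite dotDl dotNl. Qed.

Lemma dot0r n (x : 'cV[R]_n) : dot x 0 = 0.
Proof. by rewrite -(subrr x) dotBr subrr. Qed.

Lemma dot_mulmxl k n (G : 'M[R]_(k, n)) x y :
  dot (G *m x) y = dot x (G^T *m y).
Proof. by rewrite /dot trmx_mul mulmxA. Qed.

Lemma dot_ge0 n (x : 'cV[R]_n) : 0 <= dot x x.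
Proof. by rewrite dotE sumr_ge0// => i _; rewrite -expr2 sqr_ge0. Qed.

Lemma enormE n (x : 'cV[R]_n) : enorm x ^+ 2 = dot x x.
Proof.
rewrite /enorm sqr_sqrtr ?sumr_ge0// => [|i _]; last exact: sqr_ge0.
by rewrite dotE; apply: eq_bigr => i _; rewrite expr2.
Qed.

Lemma enorm_ge0 n (x : 'cV[R]_n) : 0 <= enorm x.
Proof. exact: sqrtr_ge0. Qed.

Lemma enorm0 n : enorm (0 : 'cV[R]_n) = 0.
Proof. by apply/eqP; rewrite -sqrf_eq0 enormE dot0r. Qed.

Lemma enormZ n a (x : 'cV[R]_n) : enorm (a *: x) = `|a| * enorm x.
Proof.
apply/eqP; rewrite -(@eqrXn2 _ 2) ?mulr_ge0 ?enorm_ge0//.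
by rewrite exprMn !enormE dotZl dotZr mulrA -expr2 real_normK ?num_real.
Qed.

Lemma enormN n (x : 'cV[R]_n) : enorm (- x) = enorm x.
Proof. by rewrite -scaleN1r enormZ normrN1 mul1r. Qed.

Lemma enorm_distC n (x y : 'cV[R]_n) : enorm (x - y) = enorm (y - x).
Proof. by rewrite -enormN opprB. Qed.

Lemma le_coord_enorm n (x : 'cV[R]_n) i : `|x i ord0| <= enorm x.
Proof.
rewrite -(@ler_pXn2r _ 2) ?nnegrE ?enorm_ge0// enormE dotE.
rewrite real_normK ?num_real// (bigD1 i)//= -expr2 lerDl sumr_ge0// => j _.
by rewrite -expr2 sqr_ge0.
Qed.

Lemma enorm0_eq0 n (x : 'cV[R]_n) : enorm x = 0 -> x = 0.
Proof.
move=> x0; apply/matrixP => i j; rewrite (ord1 j) mxE.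
by apply/eqP; rewrite -normr_le0 -x0 le_coord_enorm.
Qed.

Lemma dot_le_enorm n (x y : 'cV[R]_n) : dot x y <= enorm x * enorm y.
Proof.
have [x0|x0] := eqVneq (enorm x) 0.
  by rewrite x0 mul0r (enorm0_eq0 x0) dotC dot0r.
have [y0|y0] := eqVneq (enorm y) 0.
  by rewrite y0 mulr0 (enorm0_eq0 y0) dot0r.
have xp : 0 < enorm x by rewrite lt_neqAle eq_sym x0 enorm_ge0.
have yp : 0 < enorm y by rewrite lt_neqAle eq_sym y0 enorm_ge0.
have := dot_ge0 (enorm y *: x - enorm x *: y).
rewrite !dotBl !dotBr !dotZl !dotZr (dotC y x) -!enormE => h.
have : 0 <= 2 * (enorm x * enorm y) * (enorm x * enorm y - dot x y) by lra.
by rewrite pmulr_rge0 ?mulr_gt0// subr_ge0.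
Qed.

Lemma enormD n (x y : 'cV[R]_n) : enorm (x + y) <= enorm x + enorm y.
Proof.
rewrite -(@ler_pXn2r _ 2) ?nnegrE ?addr_ge0 ?enorm_ge0//.
have := dot_le_enorm x y.
rewrite sqrrD !enormE dotDl !dotDr (dotC y x) => ?; lra.
Qed.

Lemma enorm_triangle n (y x z : 'cV[R]_n) :
  enorm (x - z) <= enorm (x - y) + enorm (y - z).
Proof. by apply: le_trans (enormD _ _); rewrite addrA subrK. Qed.

(** With [le_coord_enorm], this compares the Euclidean norm with the sup norm
that defines the topology of matrices. *)
Lemma le_enorm_sum n (x : 'cV[R]_n) : enorm x <= \sum_(i < n) `|x i ord0|.
Proof.
rewrite -(@ler_pXn2r _ 2) ?nnegrE ?enorm_ge0 ?sumr_ge0// enormE dotE expr2.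
rewrite mulr_suml ler_sum// => i _.
rewrite -expr2 -real_normK ?num_real// expr2 ler_wpM2l//.
by rewrite (bigD1 i)//= lerDl sumr_ge0.
Qed.

End Euclidean.

(** * The matrix topology in terms of the Euclidean norm *)

Section EuclideanTopology.
Context {R : realType} {n : nat}.
Implicit Types (x y : 'cV[R]_n) (C : set 'cV[R]_n) (f : 'cV[R]_n -> R).

Lemma nbhs_enormP x (A : set 'cV[R]_n) :
  nbhs x A <-> exists2 e, 0 < e & forall y, enorm (x - y) < e -> A y.
Proof.
split=> [/nbhs_ballP[e /= e0 eA]|[e e0 eA]].
  exists e => // y xye; apply: eA; split=> // i j; rewrite (ord1 j).
  by apply: le_lt_trans xye; have := le_coord_enorm (x - y) i; rewrite !mxE.
apply/nbhs_ballP; exists (e / n.+1%:R) => /=; first by rewrite divr_gt0.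
move=> y [_ xy]; apply: eA; apply: le_lt_trans (le_enorm_sum _) _.
apply: (@le_lt_trans _ _ (\sum_(i < n) (e / n.+1%:R))).
  by apply: ler_sum => i _; have := xy i ord0; rewrite !mxE => /ltW.
rewrite sumr_const card_ord -[_ *+ n]mulr_natl mulrCA gtr_pMr// ltr_pdivrMr//.
by rewrite mul1r ltr_nat.
Qed.

Lemma lipschitz_enorm_continuous f (K : R) :
  (forall x y, f x <= f y + K * enorm (x - y)) -> continuous f.
Proof.
move=> fK x; apply/(@cvgrPdist_lt _ R^o _ (nbhs x)) => e e0.
have K1 : 0 < `|K| + 1 by rewrite ltr_pwDr.
apply/nbhs_enormP; exists (e / (`|K| + 1)); first by rewrite divr_gt0.
move=> y; rewrite ltr_pdivlMr// => xy.
have KK : K * enorm (x - y) < e.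
  apply: le_lt_trans xy; rewrite mulrC ler_wpM2l ?enorm_ge0//.
  by rewrite (le_trans (ler_norm K))// lerDl.
have := fK x y; have := fK y x; rewrite (enorm_distC y) ltr_norml => ? ?.
by apply/andP; split; lra.
Qed.

Lemma enorm_dist_continuous x : continuous (fun y => enorm (x - y)).
Proof.
apply: (@lipschitz_enorm_continuous _ 1) => y z.
by rewrite mul1r (enorm_distC y z) enorm_triangle.
Qed.

Lemma dot_continuous x : continuous (dot x).
Proof.
apply: (@lipschitz_enorm_continuous _ (enorm x)) => y z.
by rewrite -lerBlDl -dotBr dot_le_enorm.
Qed.

Lemma sublevel_closed f (c : R) : continuous f -> closed [set x | f x <= c].
Proof.
move=> fc; apply: (@closed_comp _ _ f [set r | r <= c]); last exact: closed_le.
by move=> ? _; exact: fc.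
Qed.

Lemma closed_enormP C x : closed C ->
  (forall e, 0 < e -> exists2 y, C y & enorm (x - y) < e) -> C x.
Proof.
move=> Cc h; apply: Cc => A /nbhs_enormP[e e0 eA].
by have [y Cy xy] := h e e0; exists y; split=> //; exact: eA.
Qed.

(** Heine-Borel for row vectors, transported by transposition, which preserves
sup norm balls. *)
Lemma enorm_bounded_closed_compact C (r : R) :
  closed C -> (forall x, C x -> enorm x <= r) -> compact C.
Proof.
move=> Cc Cr; rewrite (_ : C = [set x^T | x in [set y : 'rV[R]_n | C y^T]]).
  have trc : continuous (@trmx R 1 n).
    move=> x A /nbhs_ballP[e /= e0 eA]; apply/nbhs_ballP; exists e => //= y xy.
    by apply: eA; case: xy => _ xy; split=> // i j; rewrite !mxE; exact: xy.
  apply: continuous_compact; first by apply: continuous_subspaceT => y; exact: trc.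
  apply: bounded_closed_compact.
    exists r; split; first exact: num_real.
    move=> M rM x Cx; rewrite /= /Num.Def.normr /= mx_normrE.
    apply/bigmax_leP; split => [|[i j] _ /=].
      by apply: le_trans (ltW rM); apply: le_trans (Cr _ Cx); exact: enorm_ge0.
    apply: le_trans (ltW rM); apply: le_trans (Cr _ Cx).
    by have := le_coord_enorm x^T j; rewrite mxE (ord1 i).
  by apply: closed_comp Cc => ? _; exact: trc.
apply/seteqP; split => [x Cx|_ [y Cy <-]//].
by exists x^T; rewrite /= trmxK.
Qed.

End EuclideanTopology.

(** * Spectral norm *)

Section SpectralNorm.
Context {R : realType}.

Lemma norm_dot_le n (x y : 'cV[R]_n) : `|dot x y| <= enorm x * enorm y.
Proof.
by rewrite ler_norml lerNl -dotNl -(enormN x) dot_le_enorm enormN dot_le_enorm.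
Qed.

(** The supremum is finite, because the sum of the norms of the rows of [G]
bounds the values, by Cauchy-Schwarz. *)
Lemma le_spectral_norm m n (G : 'M[R]_(m, n)) x :
  enorm (G *m x) <= spectral_norm G * enorm x.
Proof.
have [->|x0] := eqVneq x 0; first by rewrite mulmx0 !enorm0 mulr0.
have xp : 0 < enorm x.
  rewrite lt_neqAle enorm_ge0 andbT eq_sym.
  by apply: contraNneq x0 => /enorm0_eq0->.
rewrite -ler_pdivrMr// mulrC -[(enorm x)^-1]gtr0_norm ?invr_gt0// -enormZ.
apply: ub_le_sup; last first.
  exists ((enorm x)^-1 *: x); last by rewrite -scalemxAr.
  by rewrite /= enormZ gtr0_norm ?invr_gt0// mulVf ?gt_eqF.
exists (\sum_i enorm (row i G)^T) => _ [y /= y1 <-].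
apply: le_trans (le_enorm_sum _) _; apply: ler_sum => i _.
have -> : (G *m y) i ord0 = dot (row i G)^T y.
  by rewrite dotE mxE; apply: eq_bigr => j _; rewrite !mxE.
by apply: le_trans (norm_dot_le _ _) _; rewrite ler_piMr ?enorm_ge0.
Qed.

Lemma spectral_norm_ge0 m n (G : 'M[R]_(m, n)) : 0 <= spectral_norm G.
Proof.
apply: ub_le_sup; last by exists 0; rewrite /= ?mulmx0 enorm0.
exists `|spectral_norm G| => _ [y /= y1 <-].
apply: le_trans (le_spectral_norm _ _) _.
apply: le_trans (ler_wpM2r (enorm_ge0 _) (ler_norm _)) _.
by rewrite ler_piMr.
Qed.

Lemma le_spectral_norm_tr m n (G : 'M[R]_(m, n)) y :
  enorm (G^T *m y) <= spectral_norm G * enorm y.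
Proof.
have [h0|h0] := eqVneq (enorm (G^T *m y)) 0.
  by rewrite h0 mulr_ge0 ?spectral_norm_ge0 ?enorm_ge0.
have hp : 0 < enorm (G^T *m y) by rewrite lt_neqAle eq_sym h0 enorm_ge0.
rewrite -(ler_pM2r hp) -expr2 enormE -dot_mulmxl dotC.
apply: le_trans (dot_le_enorm _ _) _.
by rewrite mulrAC mulrC ler_wpM2r ?enorm_ge0// le_spectral_norm.
Qed.

End SpectralNorm.

(** * Metric projection *)

Section Projection.
Context {R : realType} {n : nat} {C : set 'cV[R]_n}.
Hypotheses (C_neq0 : C !=set0) (C_closed : closed C).

(** Minimize the distance to [x] over the points of [C] that are at least as
close to [x] as some fixed [c] in [C]; they form a compact set. *)
Lemma metric_proj_spec x :
  C (metric_proj C x) /\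
  forall z, C z -> enorm (x - metric_proj C x) <= enorm (x - z).
Proof.
rewrite /metric_proj.
suff h : exists y, C y /\ forall z, C z -> enorm (x - y) <= enorm (x - z).
  exact: (xgetPex 0 h).
have [c Cc] := C_neq0.
pose K := C `&` [set y | enorm (x - y) <= enorm (x - c)].
have Kcpt : compact K.
  apply: (@enorm_bounded_closed_compact _ _ _ (enorm (x - c) + enorm x)).
    apply: closedI => //; apply: sublevel_closed.
    exact: enorm_dist_continuous.
  move=> y [_ /= xy]; rewrite -[y](subrK x).
  by apply: le_trans (enormD _ _) _; rewrite lerD2r (enorm_distC y).
have K0 : K !=set0 by exists c; split=> /=.
have xcont : {within K, continuous (fun y => enorm (x - y))}.
  by apply: continuous_subspaceT; exact: enorm_dist_continuous.
have [y /set_mem[Cy /= xy] ymin] := compact_EVT_min K0 Kcpt xcont.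
exists y; split=> // z Cz.
have [xz|xz] := leP (enorm (x - z)) (enorm (x - c)).
  by apply: ymin; rewrite inE.
exact: le_trans xy (ltW xz).
Qed.

Lemma metric_proj_in x : C (metric_proj C x).
Proof. by have [] := metric_proj_spec x. Qed.

Lemma metric_proj_le x z : C z -> enorm (x - metric_proj C x) <= enorm (x - z).
Proof. by have [_] := metric_proj_spec x; apply. Qed.

Hypothesis C_convex : convex_set C.

Lemma convex_segment (t : R) x y : 0 <= t -> t <= 1 -> C x -> C y ->
  C (x + t *: (y - x)).
Proof.
move=> t0 t1 Cx Cy.
have := @C_convex y x (Itv01 t0 t1) (mem_set Cy) (mem_set Cx).
move/set_mem; rewrite /conv/= /unstable.onem => Ct.
suff -> : x + t *: (y - x) = t *: y + (1 - t) *: x by [].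
by rewrite scalerBl scale1r scalerBr addrCA.
Qed.

(** Variational inequality: for [z] in [C], moving from the projection [y]
towards [z] by a small [t] stays in [C] and changes the squared distance to [x]
by [- 2 * t * d + t ^ 2 * N]; if [d] were positive this would be a decrease. *)
Lemma metric_proj_var x z : C z ->
  dot (x - metric_proj C x) (z - metric_proj C x) <= 0.
Proof.
set y := metric_proj C x => Cz; rewrite leNgt; apply/negP => d0.
set d := dot _ _ in d0; set N := dot (z - y) (z - y).
have N0 : 0 <= N by exact: dot_ge0.
have dN : 0 < d + N by rewrite ltr_pwDl.
(* this step size lies in (0, 1] and satisfies [t * N < 2 * d] *)
pose t := d / (d + N).
have t0 : 0 < t by rewrite divr_gt0.
have t1 : t <= 1 by rewrite ler_pdivrMr// mul1r lerDl.
have /metric_proj_le := convex_segment (ltW t0) t1 (metric_proj_in x) Cz.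
move=> /(_ x); rewrite -(@ler_pXn2r _ 2) ?nnegrE ?enorm_ge0// !enormE.
rewrite -/y opprD addrA.
rewrite [leRHS](_ : _ = dot (x - y) (x - y) - 2 * t * d + t * t * N).
  move=> h; have : t * (2 * d - t * N) <= 0 by lra.
  rewrite pmulr_rle0// subr_le0 leNgt => /negP; apply.
  rewrite /t mulrAC ltr_pdivrMr// -subr_gt0.
  rewrite (_ : _ - _ = 2 * d * d + d * N); last by ring.
  by rewrite ltr_pwDl ?mulr_gt0 ?mulr_ge0// ltW.
rewrite /d /N; move: (x - y) (z - y) => u v.
by rewrite !(dotBl, dotBr, dotZl, dotZr) (dotC v u); ring.
Qed.

Lemma metric_projP x y :
  metric_proj C x = y <-> C y /\ forall z, C z -> dot (x - y) (z - y) <= 0.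
Proof.
split=> [<-|[Cy hy]].
  by split=> [|z]; [exact: metric_proj_in|exact: metric_proj_var].
have := hy _ (metric_proj_in x); have := metric_proj_var x Cy.
set p := metric_proj C x => h1 h2; apply/eqP; rewrite -subr_eq0; apply/eqP.
apply: enorm0_eq0; apply/eqP; rewrite -sqrf_eq0 enormE eq_le dot_ge0 andbT.
move: h1 h2; rewrite !(dotBl, dotBr) (dotC y p); lra.
Qed.

(** Firm nonexpansiveness: add the variational inequalities at the two
projections. *)
Lemma metric_proj_firm x y :
  enorm (metric_proj C x - metric_proj C y) ^+ 2 <=
  dot (x - y) (metric_proj C x - metric_proj C y).
Proof.
have := metric_proj_var x (metric_proj_in y).
have := metric_proj_var y (metric_proj_in x).
rewrite enormE; set p := metric_proj C x; set q := metric_proj C y.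
rewrite !(dotBl, dotBr) (dotC q p); lra.
Qed.

Lemma metric_proj_id x : metric_proj C x = x <-> C x.
Proof.
rewrite metric_projP; split=> [[]//|Cx]; split=> // z _.
by rewrite subrr dotC dot0r.
Qed.

Lemma dist_metric_proj_lipschitz x y :
  enorm (x - metric_proj C x) <= enorm (y - metric_proj C y) + enorm (x - y).
Proof.
apply: le_trans (metric_proj_le x (metric_proj_in y)) _.
by rewrite [leRHS]addrC; exact: enorm_triangle.
Qed.

End Projection.

(** * One projected Landweber step *)

(** [landweber_step A b M C] is this map for [G := sqrtmx M *m A] and
[g := sqrtmx M *m b]. *)
Definition projected_landweber (R : realType) (m n : nat) (G : 'M[R]_(m, n))
    (g : 'cV[R]_m) (C : set 'cV[R]_n) (lambda : R) (x : 'cV[R]_n) : 'cV[R]_n :=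
  metric_proj C
    (x + (lambda / spectral_norm G ^+ 2) *: (G^T *m (g - G *m x))).

Section Step.
Context {R : realType} {m n : nat} {C : set 'cV[R]_n}.
Variables (G : 'M[R]_(m, n)) (g : 'cV[R]_m).
Hypotheses (C_neq0 : C !=set0) (C_closed : closed C) (C_convex : convex_set C).

Local Notation L := (spectral_norm G).
Local Notation T := (projected_landweber G g C).


Let s lambda := lambda / L ^+ 2.

(** The right hand side is the first order condition for minimizing
[enorm (g - G *m w)] over [w] in [C], so the fixed points do not depend on the
relaxation parameter. *)
Lemma projected_landweber_fixP lambda x : 0 < lambda ->
  T lambda x = x <->
  C x /\ forall w, C w -> dot (g - G *m x) (G *m (w - x)) <= 0.
Proof.
move=> l0; rewrite metric_projP//.
suff E w : (dot (x + s lambda *: (G^T *m (g - G *m x)) - x) (w - x) <= 0) =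
           (dot (g - G *m x) (G *m (w - x)) <= 0).
  by split=> -[Cx hx]; split=> // w Cw; have := hx w Cw; rewrite E.
rewrite addrC addKr dotZl dot_mulmxl trmxK.
(* if [L] is 0 the step size is 0, but then [G] is 0 as well *)
have [L0|L0] := eqVneq L 0.
  have /eqP G0 : enorm (G *m (w - x)) == 0.
    by rewrite eq_le enorm_ge0 andbT -(mul0r (enorm (w - x))) -L0 le_spectral_norm.
  by rewrite (enorm0_eq0 G0) dot0r mulr0.
by rewrite pmulr_rle0// divr_gt0// exprn_gt0// lt_neqAle eq_sym L0 spectral_norm_ge0.
Qed.

(** Least squares minimizers over [C] share their image under [G]: add the
first order conditions of two of them. Conversely that condition depends on the
point only through its image. *)
Lemma projected_landweber_fix_residual mu lambda z0 z : 0 < mu -> 0 < lambda ->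
  T mu z0 = z0 -> (T lambda z = z <-> C z /\ G *m z = G *m z0).
Proof.
move=> m0 l0 /(projected_landweber_fixP _ m0)[Cz0 h0].
rewrite (projected_landweber_fixP _ l0); split=> [[Cz h]|[Cz Gz]]; last first.
  by split=> // w Cw; rewrite mulmxBr Gz -mulmxBr; exact: h0.
split=> //; apply/eqP; rewrite -subr_eq0; apply/eqP; apply: enorm0_eq0.
apply/eqP; rewrite -sqrf_eq0 eq_le sqr_ge0 andbT enormE.
have := h _ Cz0; have := h0 _ Cz; rewrite !mulmxBr.
rewrite !(dotBl, dotBr) (dotC (G *m z0) (G *m z)); lra.
Qed.

(** With [d := x - z], [e := T x - z], [t := lambda / L ^+ 2] and
[w := d - t *: (G^T *m (G *m d)) - e], firm nonexpansiveness of the projection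
gives [enorm e ^+ 2 + enorm w ^+ 2 <= enorm (d - t *: (G^T *m (G *m d))) ^+ 2],
and the right hand side loses [eps * t * enorm (G *m d) ^+ 2] against
[enorm d ^+ 2] since [t * L ^+ 2 <= 2 - eps]. The displacement [d - e] is [w]
plus [t *: (G^T *m (G *m d))], so it is controlled by the same two gains: its
squared norm is at most [2 * dot w w + 4 * t * enorm (G *m d) ^+ 2], and one
more summand [t * enorm (G *m d) ^+ 2] leads to the factor 5. *)
Lemma projected_landweber_decrease eps lambda x z :
  0 < eps -> eps <= lambda -> lambda <= 2 - eps -> T lambda z = z ->
  enorm (x - T lambda x) ^+ 2 + s lambda * enorm (G *m (x - z)) ^+ 2 <=
  5 / eps * (enorm (x - z) ^+ 2 - enorm (T lambda x - z) ^+ 2).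
Proof.
move=> e0 el l2 Tz.
have l0 : 0 < lambda by exact: lt_le_trans el.
have s0 : 0 <= s lambda by rewrite divr_ge0 ?sqr_ge0 ?ltW.
have := metric_proj_firm C_neq0 C_closed C_convex
  (x + s lambda *: (G^T *m (g - G *m x))) (z + s lambda *: (G^T *m (g - G *m z))).
rewrite -/(T lambda x) -/(T lambda z) Tz.
set y := T lambda x.
rewrite (_ : _ + _ - _ = x - z - s lambda *: (G^T *m (G *m (x - z))));
  last first.
  rewrite !mulmxBr !scalerBr !opprB !opprD.
  by apply/matrixP => i j; rewrite !mxE; ring.
rewrite (_ : x - y = (x - z) - (y - z)); last by rewrite opprB addrA subrK.
move: (x - z) (y - z) => {x z Tz y} d e.
have hle : enorm (G^T *m (G *m d)) ^+ 2 <= L ^+ 2 * enorm (G *m d) ^+ 2.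
  rewrite -exprMn lerXn2r ?nnegrE ?mulr_ge0 ?enorm_ge0 ?spectral_norm_ge0//.
  exact: le_spectral_norm_tr.
have sL : s lambda * L ^+ 2 <= 2 - eps.
  rewrite /s; have [->|L0] := eqVneq L 0; last by rewrite divfK ?sqrf_eq0.
  by rewrite expr0n/= mulr0; lra.
have hd : dot (G^T *m (G *m d)) d = enorm (G *m d) ^+ 2.
  by rewrite dot_mulmxl trmxK enormE.
move: hle hd; set h := G^T *m _; set a := enorm (G *m d) ^+ 2.
have a0 : 0 <= a by exact: sqr_ge0.
move: (s lambda) s0 sL => t t0 tL hle hd fe.
have tth : t * t * enorm h ^+ 2 <= (2 - eps) * (t * a).
  apply: (@le_trans _ _ (t * t * (L ^+ 2 * a))).
    by rewrite ler_wpM2l// mulr_ge0.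
  rewrite (_ : _ * _ = (t * L ^+ 2) * (t * a)); last by ring.
  by rewrite ler_wpM2r// mulr_ge0.
have ta0 : 0 <= t * a by rewrite mulr_ge0.
pose w := d - t *: h - e.
have w0 := dot_ge0 w.
have key : dot w w + eps * (t * a) <= enorm d ^+ 2 - enorm e ^+ 2.
  move: fe tth; rewrite /w !enormE !(dotBl, dotBr, dotZl, dotZr).
  rewrite (dotC e d) (dotC e h) (dotC d h) hd => fe tth; lra.
have bnd : enorm (d - e) ^+ 2 <= 2 * dot w w + 4 * (t * a).
  have := dot_ge0 (w - t *: h).
  have eta : 0 <= eps * (t * a) by rewrite mulr_ge0 ?(ltW e0).
  have -> : d - e = w + t *: h by rewrite /w addrAC subrK.
  move: tth; rewrite !enormE; clearbody w.
  rewrite !(dotNl, dotNr, dotDl, dotDr, dotZl, dotZr) (dotC h w); lra.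
rewrite mulrAC ler_pdivlMr//.
have e1 : eps <= 1 by lra.
have : eps * (enorm (d - e) ^+ 2 + t * a) <= eps * (2 * dot w w + 5 * (t * a)).
  by rewrite ler_pM2l//; lra.
have : eps * dot w w <= dot w w by rewrite ler_piMl.
move=> h1 h2; lra.
Qed.

End Step.

(** * Residual of a block *)

(** If [z0] is a fixed point of the step of the block, the zeros of this
function are the fixed points. Both terms are controlled by the decrease of a
step, and for polyhedral [C] they bound, up to constants, the violation of
every linear constraint. *)
Definition residual (R : realType) (m n : nat) (G : 'M[R]_(m, n))
    (C : set 'cV[R]_n) (z0 x : 'cV[R]_n) : R :=
  enorm (x - metric_proj C x) + enorm (G *m (x - z0)).

Section Residual.
Context {R : realType} {m n : nat} {C : set 'cV[R]_n}.
Variables (G : 'M[R]_(m, n)) (g : 'cV[R]_m).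
Hypotheses (C_neq0 : C !=set0) (C_closed : closed C) (C_convex : convex_set C).

Local Notation L := (spectral_norm G).
Local Notation T := (projected_landweber G g C).
Local Notation res := (residual G C).

Lemma residual_ge0 z0 x : 0 <= res z0 x.
Proof. by rewrite addr_ge0 ?enorm_ge0. Qed.

Lemma residual_eq0 z0 x : res z0 x = 0 <-> C x /\ G *m x = G *m z0.
Proof.
rewrite -(metric_proj_id C_neq0 C_closed C_convex x).
split=> [/eqP|[Cx Gx]]; last first.
  by rewrite /residual Cx subrr mulmxBr Gx subrr !enorm0 addr0.
rewrite paddr_eq0 ?enorm_ge0// => /andP[/eqP/enorm0_eq0/eqP + /eqP/enorm0_eq0/eqP].
by rewrite mulmxBr !subr_eq0 => /eqP Cx /eqP Gx.
Qed.

Lemma residual_fixP mu lambda z0 z : 0 < mu -> 0 < lambda -> T mu z0 = z0 ->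
  res z0 z = 0 <-> T lambda z = z.
Proof.
move=> m0 l0 Tz0; rewrite residual_eq0.
by rewrite (projected_landweber_fix_residual C_neq0 C_closed C_convex z m0 l0 Tz0).
Qed.

Lemma residual_lipschitz z0 x y :
  res z0 x <= res z0 y + (1 + L) * enorm (x - y).
Proof.
have := dist_metric_proj_lipschitz C_neq0 C_closed x y.
have : enorm (G *m (x - z0)) <= enorm (G *m (y - z0)) + L * enorm (x - y).
  have -> : x - z0 = (y - z0) + (x - y) by rewrite [RHS]addrC addrA subrK.
  by rewrite mulmxDr; apply: le_trans (enormD _ _) _; rewrite lerD2l le_spectral_norm.
rewrite /residual; lra.
Qed.

(** The step ends in [C], so the distance of [x] to [C] is at most the length
of the step. The image term is recovered from the weight [lambda / L ^+ 2],
which is at least [eps / L ^+ 2]; if [L] is 0 it vanishes. *)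
Lemma residual_decrease eps mu lambda x z0 z :
  0 < eps -> 0 < mu -> eps <= lambda -> lambda <= 2 - eps ->
  T mu z0 = z0 -> res z0 z = 0 ->
  enorm (x - T lambda x) ^+ 2 + res z0 x ^+ 2 <=
  (3 + 2 * L ^+ 2 / eps) * (5 / eps) *
    (enorm (x - z) ^+ 2 - enorm (T lambda x - z) ^+ 2).
Proof.
move=> e0 m0 el l2 Tz0 rz.
have l0 : 0 < lambda by exact: lt_le_trans el.
have Tz : T lambda z = z by apply/(residual_fixP _ m0 l0 Tz0).
have /residual_eq0[_ Gz] := rz.
have dec := projected_landweber_decrease C_neq0 C_closed C_convex x e0 el l2 Tz.
rewrite -[leRHS]mulrA; set D := 5 / eps * _ in dec *.
have := metric_proj_le C_neq0 C_closed x
  (metric_proj_in C_neq0 C_closed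
    (x + (lambda / L ^+ 2) *: (G^T *m (g - G *m x)))).
rewrite -/(T lambda x) /residual (_ : G *m (x - z0) = G *m (x - z)); last first.
  by rewrite !mulmxBr Gz.
set d := enorm (x - metric_proj C x); set b := enorm (x - T lambda x).
move: dec; set a := enorm (G *m _) => dec db.
have d0 : 0 <= d by exact: enorm_ge0.
have a0 : 0 <= a by exact: enorm_ge0.
have db2 : d ^+ 2 <= b ^+ 2 by rewrite lerXn2r ?nnegrE ?(le_trans d0).
have sq : (d + a) ^+ 2 <= 2 * d ^+ 2 + 2 * a ^+ 2.
  by have := sqr_ge0 (d - a); rewrite sqrrB sqrrD; lra.
have a2 : a ^+ 2 <= L ^+ 2 / eps * (lambda / L ^+ 2 * a ^+ 2).
  have [L0|L0] := eqVneq L 0.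
    have -> : a = 0; last by rewrite expr0n/= !mulr0.
    apply/eqP; rewrite eq_le a0 andbT -(mul0r (enorm (x - z))) -L0.
    exact: le_spectral_norm.
  rewrite mulrA ler_peMl ?sqr_ge0// [leRHS](_ : _ = lambda / eps).
    by rewrite ler_pdivlMr ?mul1r.
  by field; rewrite L0 gt_eqF.
have q0 : 0 <= L ^+ 2 / eps by rewrite divr_ge0 ?sqr_ge0 ?ltW.
rewrite -/b in dec.
have b0 : 0 <= b ^+ 2 by exact: sqr_ge0.
have s0 : 0 <= lambda / L ^+ 2 * a ^+ 2.
  by rewrite !mulr_ge0 ?invr_ge0 ?sqr_ge0 ?(ltW l0).
have : L ^+ 2 / eps * (lambda / L ^+ 2 * a ^+ 2) <= L ^+ 2 / eps * D.
  by rewrite ler_wpM2l//; lra.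
lra.
Qed.

End Residual.

(** * From decay over blocks of steps to linear convergence *)

Section GeometricDecay.
Context {R : realType}.

Lemma bernoulli_ineq (d : R) j : 0 <= d -> d <= 1 -> 1 - j%:R * d <= (1 - d) ^+ j.
Proof.
move=> d0 d1; elim: j => [|j IH]; first by rewrite mul0r subr0 expr0.
rewrite exprS; apply: (@le_trans _ _ ((1 - d) * (1 - j%:R * d))).
  have : 0 <= j%:R * d * d by rewrite !mulr_ge0.
  rewrite -natr1; lra.
by rewrite ler_wpM2l// subr_ge0.
Qed.

(** The rate [q] has to satisfy [rho <= q ^+ (p + p)]; Bernoulli's inequality
provides one without taking roots. *)
Lemma geometric_of_block_decay (p : nat) (e : nat -> R) (rho : R) :
  (0 < p)%N -> 0 <= rho -> rho < 1 -> (forall k, 0 <= e k) ->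
  (forall k l, (k <= l)%N -> e l <= e k) ->
  (forall k, e (k + p)%N ^+ 2 <= rho * e k ^+ 2) ->
  exists c q, [/\ 0 <= c, 0 < q, q < 1 & forall k, e k <= c * q ^+ k].
Proof.
move=> p0 r0 r1 e0 emono edec.
have p2 : 0 < (p + p)%:R :> R by rewrite ltr0n addn_gt0 p0.
have p2' : 1 < (p + p)%:R :> R.
  by rewrite ltr1n; case: (p) p0 => // j _; rewrite addSn addnS.
pose d := (1 - rho) / (p + p)%:R.
have d0 : 0 < d by rewrite divr_gt0// subr_gt0.
have d1 : d < 1 by rewrite ltr_pdivrMr// mul1r; lra.
pose q := 1 - d.
have q0 : 0 < q by rewrite subr_gt0.
have q1 : q < 1 by rewrite /q; lra.
have rq : rho <= q ^+ (p + p).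
  have := bernoulli_ineq (p + p) (ltW d0) (ltW d1).
  by rewrite /d mulrC divfK ?gt_eqF// opprB addrC subrK.
have step k : e (k + p)%N <= q ^+ p * e k.
  rewrite -(@ler_pXn2r _ 2) ?nnegrE ?mulr_ge0 ?exprn_ge0 ?(ltW q0)//.
  apply: le_trans (edec k) _.
  by rewrite exprMn -exprM muln2 -addnn ler_wpM2r ?sqr_ge0.
(* dividing by [q ^+ p] covers the first [p] indices, where [e k <= e 0] *)
exists (e 0%N / q ^+ p), q; split=> //; first by rewrite divr_ge0// exprn_ge0// ltW.
elim/ltn_ind => k IH; have [kp|pk] := ltnP k p.
  apply: le_trans (emono 0%N k _) _ => //.
  rewrite mulrAC ler_pdivlMr ?exprn_gt0// ler_wpM2l//.
  by rewrite ler_wiXn2l ?(ltW q0) ?(ltW q1)// ltnW.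
rewrite -(subnK pk); apply: le_trans (step _) _.
rewrite exprD mulrA [leRHS]mulrC ler_wpM2l ?exprn_ge0 ?(ltW q0)//.
by apply: IH; rewrite ltn_subrL p0 (leq_trans p0 pk).
Qed.

End GeometricDecay.

(** * Cyclic Fejer monotone sequences *)

(** The function [v t] measures how far a point is from the target set of block
[t]. The blocks enter only through these functions and the decrease inequality.
*)
Section CyclicFejer.
Context {R : realType} {n p : nat}.
Variables (p_gt0 : (0 < p)%N) (v : 'I_p -> 'cV[R]_n -> R) (K kappa : R).
Hypotheses (K_ge0 : 0 <= K) (kappa_ge0 : 0 <= kappa).
Hypothesis v_ge0 : forall t x, 0 <= v t x.
Hypothesis v_lipschitz : forall t x y, v t x <= v t y + K * enorm (x - y).

Let F : set 'cV[R]_n := [set z | forall t, v t z = 0].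

Variable x : nat -> 'cV[R]_n.
Hypothesis x_decrease : forall k z, F z ->
  enorm (x k - x k.+1) ^+ 2 + v (cyclic p_gt0 k) (x k) ^+ 2 <=
  kappa * (enorm (x k - z) ^+ 2 - enorm (x k.+1 - z) ^+ 2).

Lemma fejer_succ k z : F z -> enorm (x k.+1 - z) <= enorm (x k - z).
Proof.
move=> Fz; have := x_decrease k Fz.
(* if [kappa] is 0 the sequence is constant *)
have [k0|k0] := eqVneq kappa 0.
  rewrite k0 mul0r => h; have /eqP : enorm (x k - x k.+1) == 0.
    by rewrite -sqrf_eq0 eq_le sqr_ge0 andbT (le_trans _ h)// lerDl sqr_ge0.
  by move/enorm0_eq0/eqP; rewrite subr_eq0 => /eqP ->.
have kp : 0 < kappa by rewrite lt_neqAle eq_sym k0.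
move=> h; rewrite -(@ler_pXn2r _ 2) ?nnegrE ?enorm_ge0// -subr_ge0.
rewrite -(pmulr_rge0 _ kp) (le_trans _ h)// addr_ge0 ?sqr_ge0//.
Qed.

Lemma fejer k l z : F z -> (k <= l)%N -> enorm (x l - z) <= enorm (x k - z).
Proof.
move=> Fz; elim: l => [|l IH]; first by rewrite leqn0 => /eqP ->.
rewrite leq_eqVlt => /predU1P[->//|]; rewrite ltnS => /IH.
exact: le_trans (fejer_succ _ Fz).
Qed.

Let Delta k z := enorm (x k - z) ^+ 2 - enorm (x (k + p)%N - z) ^+ 2.

Lemma Delta_ge0 k z : F z -> 0 <= Delta k z.
Proof.
by move=> Fz; rewrite subr_ge0 lerXn2r ?nnegrE ?enorm_ge0// fejer ?leq_addr.
Qed.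

Lemma cyclic_reach k (t : 'I_p) : exists2 j, (j < p)%N & cyclic p_gt0 (k + j) = t.
Proof.
exists ((t + (p - k %% p)) %% p)%N; first exact: ltn_pmod.
apply: val_inj => /=; rewrite modnDmr; have /ltnW kp := ltn_pmod k p_gt0.
have -> : (k + (t + (p - k %% p)) = (k %/ p).+1 * p + t)%N.
  by rewrite {1}(divn_eq k p) addnACA subnKC// mulSn addnC addnA.
by rewrite modnMDl modn_small.
Qed.

(** Block [t] is active at some step [k + j] with [j < p]. Its residual there
and the lengths of the steps from [k] to [k + j] are all at most [r], the
square root of [kappa] times the decrease over the cycle, and the Lipschitz
property carries the bound back to [x k]. *)
Lemma residual_cycle t k z : F z ->
  v t (x k) ^+ 2 <= (1 + K * p%:R) ^+ 2 * kappa * Delta k z.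
Proof.
move=> Fz; pose r := Num.sqrt (kappa * Delta k z).
have r2 : r ^+ 2 = kappa * Delta k z by rewrite sqr_sqrtr// mulr_ge0 ?Delta_ge0.
have r0 : 0 <= r by exact: sqrtr_ge0.
have dec j : (j < p)%N -> enorm (x (k + j)%N - x (k + j).+1) ^+ 2 +
    v (cyclic p_gt0 (k + j)) (x (k + j)%N) ^+ 2 <= r ^+ 2.
  move=> jp; apply: le_trans (x_decrease _ Fz) _; rewrite r2 ler_wpM2l//.
  apply: lerB; rewrite lerXn2r ?nnegrE ?enorm_ge0// fejer ?leq_addr//.
  by rewrite -addnS leq_add2l.
have drift j : (j <= p)%N -> enorm (x k - x (k + j)%N) <= j%:R * r.
  elim: j => [|j IH] jp; first by rewrite addn0 subrr enorm0 mul0r.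
  apply: le_trans (enorm_triangle (x (k + j)%N) _ _) _.
  rewrite -natr1 mulrDl mul1r addnS lerD ?IH ?(ltnW jp)//.
  rewrite -(@ler_pXn2r _ 2) ?nnegrE ?enorm_ge0//.
  by apply: le_trans (dec _ jp); rewrite lerDl sqr_ge0.
have [j jp jt] := cyclic_reach k t.
have vj : v t (x (k + j)%N) <= r.
  rewrite -(@ler_pXn2r _ 2) ?nnegrE//.
  by apply: le_trans (dec _ jp); rewrite jt lerDr sqr_ge0.
rewrite -mulrA -r2 -exprMn lerXn2r ?nnegrE ?mulr_ge0 ?addr_ge0 ?mulr_ge0//.
apply: le_trans (v_lipschitz t _ (x (k + j)%N)) _.
rewrite mulrDl mul1r lerD// -mulrA ler_wpM2l//.
by apply: le_trans (drift _ (ltnW jp)) _; rewrite ler_wpM2r// ler_nat ltnW.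
Qed.

Hypothesis F_neq0 : F !=set0.

(** The squared distances to a point of [F] form a convergent sequence, so
their decrease over a cycle tends to 0. *)
Lemma residual_vanishes t e : 0 < e ->
  exists N, forall k, (N <= k)%N -> v t (x k) < e.
Proof.
move=> e0; have [z Fz] := F_neq0.
set c := (1 + K * p%:R) ^+ 2 * kappa.
have c0 : 0 <= c by rewrite mulr_ge0 ?sqr_ge0.
pose a k := enorm (x k - z) ^+ 2.
have a_mono : {homo a : i j / (i <= j)%N >-> j <= i}.
  by move=> i j ij; rewrite /a lerXn2r ?nnegrE ?enorm_ge0// fejer.
have a_lb : has_lbound (range a) by exists 0 => _ [k _ <-]; exact: sqr_ge0.
have := nonincreasing_cvgn a_mono a_lb; set l := inf _ => al.
have lea k : l <= a k by apply: ge_inf => //; exists k.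
have /(@cvgrPdist_lt _ R^o) := al.
move=> /(_ (e ^+ 2 / (c + 1))); rewrite divr_gt0 ?exprn_gt0 ?ltr_pwDr// => /(_ isT).
move=> [N _ hN]; exists N => k Nk.
have := hN k Nk; rewrite /= distrC ger0_norm ?subr_ge0// => ak.
rewrite -(@ltr_pXn2r _ 2) ?nnegrE ?(ltW e0)//.
apply: le_lt_trans (residual_cycle t k Fz) _; rewrite -/c.
have /le_lt_trans/(_ ak) : Delta k z <= a k - l by rewrite lerB// lea.
rewrite ltr_pdivlMr ?ltr_pwDr// => h.
by apply: le_lt_trans h; rewrite mulrC ler_wpM2l ?Delta_ge0// lerDl.
Qed.

Lemma cluster_point_exists : exists xs, forall e N, 0 < e ->
  exists2 k, (N <= k)%N & enorm (xs - x k) < e.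
Proof.
have [z Fz] := F_neq0.
have Bcpt : compact [set y | enorm (z - y) <= enorm (x 0%N - z)].
  apply: (@enorm_bounded_closed_compact _ _ _ (enorm (x 0%N - z) + enorm z)).
    by apply: sublevel_closed; exact: enorm_dist_continuous.
  move=> y /= zy; rewrite -[y](subrK z).
  by apply: le_trans (enormD _ _) _; rewrite lerD2r (enorm_distC y).
have [|xs [_ xsP]] := Bcpt (x @ \oo) _.
  by exists 0%N => // k _ /=; rewrite (enorm_distC z) fejer.
exists xs => e N e0.
have [||y [[k Nk <-] xk]] :=
  xsP [set x k | k in [set k | (N <= k)%N]] [set y | enorm (xs - y) < e].
- by exists N => // k Nk; exists k.
- by apply/nbhs_enormP; exists e.
by exists k.
Qed.

Lemma cyclic_fejer_cvg : exists2 xs, F xs & x k @[k --> \oo] --> xs.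
Proof.
have [xs xsP] := cluster_point_exists.
have Fxs : F xs.
  move=> t; apply/eqP; rewrite eq_le v_ge0 andbT; apply/ler_addgt0Pr => e e0.
  rewrite add0r.
  have e2 : 0 < e / 2 by lra.
  have [N hN] := residual_vanishes t e2.
  have [|k Nk xk] := xsP (e / 2 / (K + 1)) N; first by rewrite divr_gt0// ltr_pwDr.
  apply: le_trans (v_lipschitz t xs (x k)) _.
  move: xk; rewrite ltr_pdivlMr ?ltr_pwDr// => xk.
  have := hN k Nk; have := enorm_ge0 (xs - x k); lra.
exists xs => // A /nbhs_enormP[e e0 eA].
have [k _ xk] := xsP e 0%N e0.
exists k => // l /= kl; apply: eA; apply: le_lt_trans xk.
by rewrite enorm_distC (enorm_distC xs) fejer.
Qed.

Lemma fejer_lim k (xs z : 'cV[R]_n) : F z -> x l @[l --> \oo] --> xs ->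
  enorm (xs - z) <= enorm (x k - z).
Proof.
move=> Fz xxs; apply/ler_addgt0Pr => e e0.
have [N _ hN] : \forall l \near \oo, enorm (xs - x l) < e.
  apply: (xxs [set y | enorm (xs - y) < e]); apply/nbhs_enormP; exists e => //.
have := hN (maxn N k) (leq_maxl _ _) => /= xN.
apply: le_trans (enorm_triangle (x (maxn N k)) _ _) _.
by rewrite addrC lerD ?(ltW xN)// fejer// leq_maxr.
Qed.

(** By [fejer_lim] the limit is at most as far from [z] as [x k] is, so the
distance of [x k] to the limit is at most twice the distance to the point [z]
of [F] given by the error bound; [residual_cycle], used with the limit as
reference point, then bounds it by its own decrease over a cycle. *)
Lemma cyclic_fejer_linear (xs : 'cV[R]_n) c : F xs -> x k @[k --> \oo] --> xs ->
  (forall y, exists2 z, F z & enorm (y - z) <= c * \sum_t v t y) ->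
  linear_cvg x xs.
Proof.
move=> Fxs xxs err.
set B := (1 + K * p%:R) ^+ 2 * kappa.
have B0 : 0 <= B by rewrite mulr_ge0 ?sqr_ge0.
set c' := `|c|.
(* adding 1 makes the contraction factor [1 - C^-1] well defined and nonnegative *)
pose C := (2 * c' * p%:R) ^+ 2 * B + 1.
have C0 : 0 < C by rewrite ltr_pwDr// mulr_ge0 ?sqr_ge0.
have contr k : enorm (x k - xs) ^+ 2 <= C * Delta k xs.
  have D0 := Delta_ge0 k Fxs.
  pose r := Num.sqrt (B * Delta k xs).
  have r2 : r ^+ 2 = B * Delta k xs by rewrite sqr_sqrtr// mulr_ge0.
  have vr t : v t (x k) <= r.
    rewrite -(@ler_pXn2r _ 2) ?nnegrE ?sqrtr_ge0// r2.
    exact: residual_cycle.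
  have [z Fz xz] := err (x k).
  have xkxs : enorm (x k - xs) <= 2 * c' * p%:R * r.
    apply: le_trans (enorm_triangle z _ _) _.
    rewrite (enorm_distC z) -!mulrA mulr_natl mulr2n.
    have xz' : enorm (x k - z) <= c' * (p%:R * r).
      apply: le_trans xz _.
      apply: (@le_trans _ _ (c' * \sum_t v t (x k))).
        by rewrite ler_wpM2r ?sumr_ge0// ler_norm.
      rewrite ler_wpM2l ?normr_ge0// mulr_natl -[p in leRHS]card_ord -sumr_const.
      exact: ler_sum.
    by apply: lerD => //; apply: le_trans (fejer_lim k Fz xxs) xz'.
  apply: (@le_trans _ _ ((2 * c' * p%:R * r) ^+ 2)).
    by rewrite lerXn2r ?nnegrE ?enorm_ge0// (le_trans _ xkxs) ?enorm_ge0.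
  by rewrite exprMn r2 mulrA ler_wpM2r// lerDl.
apply: (@geometric_of_block_decay _ p (fun k => enorm (x k - xs)) (1 - C^-1)) => //.
- rewrite subr_ge0 invf_le1// /C lerDr mulr_ge0 ?sqr_ge0//.
- by rewrite ltrBlDr ltrDl invr_gt0.
- by move=> k; exact: enorm_ge0.
- by move=> k l kl; exact: fejer.
move=> k; have := contr k; rewrite mulrC -ler_pdivrMr// /Delta => h.
by rewrite mulrBl mul1r; lra.
Qed.

End CyclicFejer.

(** * Hoffman's inequality *)

Section Hoffman.
Context {R : realType} {n : nat} {I : finType}.
Variables (a : I -> 'cV[R]_n) (beta : I -> R).

Let P : set 'cV[R]_n := [set x | forall i, dot (a i) x <= beta i].

Lemma polyhedron_closed : closed P.
Proof.
rewrite (_ : P = \bigcap_i [set x | dot (a i) x <= beta i]).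
  by apply: closed_bigI => i _; apply: sublevel_closed; exact: dot_continuous.
by apply/seteqP; split=> [x Px i _|x Px i]; exact: Px.
Qed.

Lemma polyhedron_convex : convex_set P.
Proof.
move=> x y l /set_mem Px /set_mem Py; apply/mem_set => i.
rewrite dotDr !dotZr.
rewrite (_ : beta i = l%:num * beta i + (1 - l%:num) * beta i); last by ring.
by rewrite lerD// ler_wpM2l ?subr_ge0.
Qed.

Let excess (J : {set I}) u := \sum_(j in J) Num.max 0 (dot (a j) u).

(** [polar J] is the polar cone of the directions allowed by the constraints in
[J]; for [J] active at [z], it is the normal cone of [P] at [z]. *)
Let polar (J : {set I}) : set 'cV[R]_n :=
  [set u | forall w, (forall j, j \in J -> dot (a j) w <= 0) -> dot w u <= 0].

Lemma excess_continuous J : continuous (excess J).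
Proof.
apply: (@lipschitz_enorm_continuous _ _ _ (\sum_(j in J) enorm (a j))) => x y.
rewrite mulr_suml -big_split/= ler_sum// => j _.
have := dot_le_enorm (a j) (x - y); rewrite dotBr => h.
have : 0 <= enorm (a j) * enorm (x - y) by rewrite mulr_ge0 ?enorm_ge0.
by have [] := leP 0 (dot (a j) x); have [] := leP 0 (dot (a j) y); lra.
Qed.

Lemma excessZ J (s : R) u : 0 <= s -> excess J (s *: u) = s * excess J u.
Proof.
move=> s0; rewrite mulr_sumr; apply: eq_bigr => j _.
by rewrite dotZr maxr_pMr// mulr0.
Qed.

(** On the unit vectors of the closed cone [polar J] the continuous function
[excess J] attains its minimum. It is positive: a unit vector [u] with zero
excess would satisfy the constraints defining the directions, hence
[dot u u <= 0]. The general case follows by homogeneity. *)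
Lemma polar_excess J : exists2 c, 0 < c &
  forall u, polar J u -> c * enorm u <= excess J u.
Proof.
pose S := polar J `&` [set u | enorm u = 1].
have normalize u : polar J u -> enorm u != 0 -> S ((enorm u)^-1 *: u).
  move=> Ju u0; have iu : 0 <= (enorm u)^-1 by rewrite invr_ge0 enorm_ge0.
  split; last by rewrite /= enormZ ger0_norm// mulVf.
  by move=> w Jw; rewrite dotZr mulr_ge0_le0// Ju.
(* without unit vectors the cone is reduced to 0 and any constant will do *)
have [S0|S0] := pselect (S !=set0); last first.
  exists 1 => // u Ju; have [u0|u0] := eqVneq (enorm u) 0.
    by rewrite u0 mulr0 sumr_ge0// => j _; rewrite le_max lexx.
  by case: S0; exists ((enorm u)^-1 *: u); exact: normalize.
have Scpt : compact S.
  apply: (@enorm_bounded_closed_compact _ _ _ 1); last by move=> u [_ /= ->].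
  apply: closedI.
    rewrite (_ : polar J =
      \bigcap_(w in [set w | forall j, j \in J -> dot (a j) w <= 0])
        [set u | dot w u <= 0]).
      by apply: closed_bigI => w _; apply: sublevel_closed; exact: dot_continuous.
    by apply/seteqP; split=> u Ju w; exact: Ju.
  apply: (@closed_comp _ _ (fun u : 'cV[R]_n => enorm u) [set r | r = 1]);
    last exact: closed_eq.
  move=> u _; rewrite (_ : (fun u => _) = (fun u : 'cV[R]_n => enorm (0 - u))).
    exact: enorm_dist_continuous.
  by apply/funext => y; rewrite sub0r enormN.
have ec : {within S, continuous (excess J)}.
  by apply: continuous_subspaceT; exact: excess_continuous.
have [u0 /set_mem[Ju0 u01] umin] := compact_EVT_min S0 Scpt ec.
exists (excess J u0).
  rewrite ltNge; apply/negP => e0.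
  suff : dot u0 u0 <= 0 by rewrite -enormE u01 expr1n ler10.
  apply: Ju0 => j jJ; apply: le_trans e0.
  rewrite /excess (bigD1 j)//= -[leLHS]addr0 lerD ?le_max ?lexx ?orbT//.
  by rewrite sumr_ge0// => i _; rewrite le_max lexx.
move=> u Ju; have [u00|u00] := eqVneq (enorm u) 0.
  by rewrite u00 mulr0 sumr_ge0// => j _; rewrite le_max lexx.
have := umin _ (mem_set (normalize u Ju u00)).
rewrite excessZ ?invr_ge0 ?enorm_ge0// mulrC ler_pdivlMr//.
by rewrite lt_neqAle eq_sym u00 enorm_ge0.
Qed.

Let active z : {set I} := [set i | dot (a i) z == beta i].

(** A direction [w] allowed by the active constraints is feasible for a short
time, because the other constraints have positive slack. *)
Lemma polar_of_normal x z : P z -> (forall w, P w -> dot (x - z) (w - z) <= 0) ->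
  polar (active z) (x - z).
Proof.
move=> Pz h w Jw.
pose q i := `|dot (a i) w| / (beta i - dot (a i) z).
have q0 i : 0 <= q i by rewrite divr_ge0// subr_ge0 Pz.
(* [t * q i <= 1] for all [i], which keeps the constraints with slack satisfied *)
pose t := (1 + \sum_i q i)^-1.
have t0 : 0 < t by rewrite invr_gt0 ltr_pwDl// sumr_ge0.
have : dot (x - z) (z + t *: w - z) <= 0.
  apply: h => i; rewrite dotDr dotZr.
  have [iJ|iJ] := boolP (i \in active z).
    have := Jw _ iJ; move: iJ; rewrite inE => /eqP <- wi.
    by rewrite gerDl pmulr_rle0.
  have sl : 0 < beta i - dot (a i) z.
    by rewrite subr_gt0 lt_neqAle Pz andbT; rewrite inE in iJ.
  rewrite -lerBrDl; apply: le_trans (ler_wpM2l (ltW t0) (ler_norm _)) _.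
  rewrite mulrC -ler_pdivlMr// /t invrK mulrC -ler_pdivrMr// -/(q i).
  by rewrite (bigD1 i)//= addrCA lerDl addr_ge0// sumr_ge0.
by rewrite addrAC subrr add0r dotZr pmulr_rle0// dotC.
Qed.

(** Project [x] to [z] in [P]. The vector [x - z] lies in the polar cone of the
active set [J] at [z], and for [j] in [J] the product [dot (a j) (x - z)] is
the violation of constraint [j] at [x]. The constant of [polar_excess] depends
only on [J], and there are finitely many sets [J]. *)
Theorem hoffman : P !=set0 -> exists2 c, 0 <= c &
  forall x delta, 0 <= delta -> (forall i, dot (a i) x <= beta i + delta) ->
  exists2 z, P z & enorm (x - z) <= c * delta.
Proof.
move=> P0.
pose c J := s2val (cid2 (polar_excess J)).
have c_gt0 J : 0 < c J by exact: (s2valP (cid2 (polar_excess J))).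
have cP J u : polar J u -> c J * enorm u <= excess J u.
  exact: (s2valP' (cid2 (polar_excess J))).
pose B := \sum_J (#|I|%:R / c J).
have B_ge J : #|I|%:R / c J <= B.
  rewrite /B (bigD1 J)//= lerDl sumr_ge0// => K _.
  by rewrite divr_ge0// ltW.
exists B => [|x delta d0 xd].
  by apply: sumr_ge0 => J _; rewrite divr_ge0// ltW.
pose z := metric_proj P x.
have Pz : P z := metric_proj_in P0 polyhedron_closed x.
exists z => //; pose J := active z.
apply: le_trans (ler_wpM2r d0 (B_ge J)).
rewrite mulrAC ler_pdivlMr// mulrC.
have zP w : P w -> dot (x - z) (w - z) <= 0.
  exact: (metric_proj_var P0 polyhedron_closed polyhedron_convex).
apply: le_trans (cP _ _ (polar_of_normal Pz zP)) _.
apply: (@le_trans _ _ (\sum_(j in J) delta)).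
  apply: ler_sum => j; rewrite inE => /eqP az.
  by rewrite ge_max d0 dotBr az lerBlDl xd.
by rewrite sumr_const -[delta *+ _]mulr_natl ler_wpM2r// ler_nat max_card.
Qed.

End Hoffman.

(** Hoffman's inequality for the system formed by the half-spaces of all the
[C t] and the equations [G t *m z = G t *m z0]. The residual of block [t]
bounds the violation of a half-space of [C t] up to the norm of its normal
vector, because the projection to [C t] satisfies it. *)
Lemma polyhedral_error_bound (R : realType) (n : nat) (T : finType)
    (m : T -> nat) (G : forall t, 'M[R]_(m t, n)) (C : T -> set 'cV[R]_n)
    (z0 : 'cV[R]_n) :
  (forall t, C t z0) -> (forall t, closed (C t)) ->
  (forall t, polyhedral (C t)) ->
  exists c, forall x, exists2 z, (forall t, C t z /\ G t *m z = G t *m z0) &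
    enorm (x - z) <= c * \sum_t residual (G t) (C t) z0 x.
Proof.
move=> Cz0 Cc Cpoly.
have repr t : {r : nat & {h : 'I_r -> 'cV[R]_n * R |
    C t = [set x | forall i, dot (h i).1 x <= (h i).2]}}.
  have [r /cid[H [Hh CH]]] := cid (Cpoly t); exists r.
  have h i : {h : 'cV[R]_n * R | H i = [set x | dot h.1 x <= h.2]}.
    by have [a /cid[b [_ Hi]]] := cid (Hh i); exists (a, b).
  exists (fun i => sval (h i)); rewrite CH; apply/seteqP; split=> x Cx i.
    by have := Cx i I; rewrite {1}(svalP (h i)).
  by move=> _; rewrite (svalP (h i)); exact: Cx.
pose r t := projT1 (repr t); pose h t := sval (projT2 (repr t)).
have Ch t : C t = [set x | forall i, dot (h t i).1 x <= (h t i).2] :=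
  svalP (projT2 (repr t)).
(* each equation of [G t *m z = G t *m z0] is a pair of opposite inequalities *)
pose J := {t : T & ('I_(r t) + 'I_(m t) * bool)%type}.
pose eqn t (jb : 'I_(m t) * bool) := (-1) ^+ jb.2 *: (row jb.1 (G t))^T.
pose a (s : J) := match tagged s with
  | inl i => (h (tag s) i).1 | inr jb => @eqn (tag s) jb end.
pose beta (s : J) := match tagged s with
  | inl i => (h (tag s) i).2 | inr jb => dot (@eqn (tag s) jb) z0 end.
have eqnE t jb x : dot (@eqn t jb) x = (-1) ^+ jb.2 * (G t *m x) jb.1 ord0.
  by rewrite dotZl dotE mxE; congr (_ * _); apply: eq_bigr => k _; rewrite !mxE.
have [|c c0 cP] := @hoffman R n J a beta.
  exists z0 => -[t [i|jb]] //=; have := Cz0 t; rewrite {1}Ch; exact.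
pose A := 1 + \sum_s enorm (a s).
have A_ge s : enorm (a s) <= A.
  rewrite /A (bigD1 s)//= addrCA lerDl addr_ge0// sumr_ge0// => *.
  exact: enorm_ge0.
have A1 : 1 <= A by rewrite lerDl sumr_ge0// => *; exact: enorm_ge0.
have A0 : 0 <= A by exact: le_trans A1.
exists (c * A) => x; set V := \sum_t _.
have V_ge t : residual (G t) (C t) z0 x <= V.
  by rewrite /V (bigD1 t)//= lerDl sumr_ge0// => *; exact: residual_ge0.
have V0 : 0 <= V by rewrite sumr_ge0// => *; exact: residual_ge0.
have [||z Pz xz] := cP x (A * V);
  [by rewrite mulr_ge0| |exists z; rewrite -?mulrA//].
- move=> s; rewrite -lerBlDl; case: s => t [i|jb].
    set s := (X in a X); have := metric_proj_in (ex_intro _ _ (Cz0 t)) (Cc t) x.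
    rewrite {1}Ch => /(_ i) Px.
    apply: (@le_trans _ _ (dot (a s) (x - metric_proj (C t) x))).
      by rewrite dotBr lerB.
    apply: le_trans (dot_le_enorm _ _) _; apply: ler_pM; rewrite ?enorm_ge0//.
    by apply: le_trans (V_ge t); rewrite lerDl enorm_ge0.
  rewrite /a /beta /= -dotBr eqnE; apply: (@le_trans _ _ V); last by rewrite ler_peMl.
  apply: le_trans (ler_norm _) _; rewrite normrM normrX normrN1 expr1n mul1r.
  apply: le_trans (le_coord_enorm _ _) _.
  by apply: le_trans (V_ge t); rewrite lerDr enorm_ge0.
move=> t; split.
  rewrite Ch => i.
  exact: (Pz (Tagged (fun t => ('I_(r t) + 'I_(m t) * bool)%type) (inl i))).
apply/matrixP => j k; rewrite (ord1 k).
pose s b : J := Tagged (fun t => ('I_(r t) + 'I_(m t) * bool)%type) (inr (j, b)).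
have := Pz (s true); have := Pz (s false).
rewrite /a /beta /s /= !eqnE /= expr0 expr1 !mul1r !mulN1r lerN2 => h1 h2.
by apply/eqP; rewrite eq_le h1.
Qed.

(** * Convergence of the cyclic projected Landweber method *)

Unset Implicit Arguments.

Theorem theorem1p3 (R : realType) (m n p : nat) (p_gt0 : (0 < p)%N)
    (A : 'M[R]_(m, n)) (b : 'cV[R]_m)
    (B : 'I_p -> {set 'I_m})
    (Bcover : forall i : 'I_m, exists t : 'I_p, i \in B t)
    (A_neq0 : forall t : 'I_p, row_block (B t) A != 0)
    (M : forall t : 'I_p, 'M[R]_#|B t|)
    (M_spd : forall t : 'I_p, spd (M t))
    (C : 'I_p -> set 'cV[R]_n)
    (C_nonempty : forall t : 'I_p, C t !=set0)
    (C_closed : forall t : 'I_p, closed (C t))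
    (C_convex : forall t : 'I_p, convex_set (C t))
    (lambda : R) (lambda_gt0 : 0 < lambda) (lambda_lt2 : lambda < 2)
    (eps : R) (eps_gt0 : 0 < eps) (eps_lt1 : eps < 1)
    (lam : nat -> R)
    (lam_bounds : forall k : nat, eps <= lam k /\ lam k <= 2 - eps) :
  let U := fun t : 'I_p =>
    landweber_step (row_block (B t) A) (row_block (B t) b) (M t) (C t) in
  \bigcap_t Fix (U t lambda) !=set0 ->
  forall (x0 : 'cV[R]_n) (x : nat -> 'cV[R]_n),
    x 0%N = x0 ->
    (forall k : nat, x k.+1 = U (cyclic p_gt0 k) (lam k) (x k)) ->
    exists xs : 'cV[R]_n,
      [/\ (\bigcap_t Fix (U t lambda)) xs,
          x k @[k --> \oo] --> xs &
          (forall t : 'I_p, polyhedral (C t)) -> linear_cvg x xs].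
Proof.
move=> U [z0 Uz0] x0 x _ xS.
pose G t := sqrtmx (M t) *m row_block (B t) A.
pose g t := sqrtmx (M t) *m row_block (B t) b.
have UE t l : U t l = projected_landweber (G t) (g t) (C t) l by [].
have Gz0 t : projected_landweber (G t) (g t) (C t) lambda z0 = z0 by exact: Uz0.
pose v t := residual (G t) (C t) z0.
have v0P t z : v t z = 0 <-> U t lambda z = z.
  exact: (residual_fixP (C_nonempty t) (C_closed t) (@C_convex t) z
    lambda_gt0 lambda_gt0 (Gz0 t)).
pose K : R := 1 + \sum_t spectral_norm (G t).
pose kap t : R := (3 + 2 * spectral_norm (G t) ^+ 2 / eps) * (5 / eps).
have kap0 t : 0 < kap t.
  apply: mulr_gt0; last exact: divr_gt0.
  apply: ltr_pwDl => //; apply: divr_ge0; last exact: ltW.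
  by rewrite mulr_ge0// sqr_ge0.
pose kappa : R := \sum_t kap t.
have K0 : 0 <= K by rewrite addr_ge0 ?sumr_ge0// => t _; exact: spectral_norm_ge0.
have kappa0 : 0 <= kappa by apply: sumr_ge0 => t _; exact: ltW.
have v0 t y : 0 <= v t y by exact: residual_ge0.
have vL t y z : v t y <= v t z + K * enorm (y - z).
  apply: le_trans (residual_lipschitz _ (C_nonempty t) (C_closed t) z0 y z) _.
  rewrite lerD2l ler_wpM2r ?enorm_ge0// lerD2l (bigD1 t)//= lerDl sumr_ge0// => *.
  exact: spectral_norm_ge0.
have xdec k z : (forall t, v t z = 0) ->
    enorm (x k - x k.+1) ^+ 2 + v (cyclic p_gt0 k) (x k) ^+ 2 <=
    kappa * (enorm (x k - z) ^+ 2 - enorm (x k.+1 - z) ^+ 2).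
  move=> vz; set t := cyclic p_gt0 k; have [el l2] := lam_bounds k.
  rewrite xS -/t UE.
  have dec := residual_decrease (C_nonempty t) (C_closed t) (@C_convex t) (x k)
    eps_gt0 lambda_gt0 el l2 (Gz0 t) (vz t).
  apply: le_trans (dec) _; rewrite -/(kap t) ler_wpM2r//; last first.
    by rewrite /kappa (bigD1 t)//= lerDl sumr_ge0// => *; exact: ltW.
  by rewrite -(pmulr_rge0 _ (kap0 t)) (le_trans _ dec)// addr_ge0 ?sqr_ge0.
have F0 : [set z | forall t, v t z = 0] !=set0.
  by exists z0 => t; apply/v0P; exact: Uz0.
have [xs Fxs xxs] := cyclic_fejer_cvg K0 kappa0 v0 vL xdec F0.
exists xs; split=> // [t _|Cpoly]; first by apply/v0P; exact: Fxs.
have z0C t : C t z0.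
  by have /residual_eq0[] : v t z0 = 0 by apply/v0P; exact: Uz0.
have [c cP] := polyhedral_error_bound G z0C C_closed Cpoly.
apply: (cyclic_fejer_linear (c := c) K0 kappa0 v0 vL xdec Fxs xxs) => y.
have [z zP yz] := cP y; exists z => // t.
exact/(residual_eq0 _ (C_nonempty t) (C_closed t) (@C_convex t))/zP.
Qed.
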